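(* Let $1<p<q<\infty$ and $\theta=\frac{q}{q-1}\cdot\frac{p-1}{p}$ (so $0<\theta<1$). Let $X_0$ be the Banach lattice of all real sequences $f=(x_I)_{I\in\mathcal D}$ for which $$\|f\|_{X_0}=\sup\Big\{\big\|(|x_I|^{1-\theta}|y_I|^\theta)_{I\in\mathcal D}\big\|_{f_p^q}^{\frac1{1-\theta}}:\ y=(y_I)_{I\in\mathcal D}\in f_q^q,\ \|y\|_{f_q^q}\le1\Big\}<\infty.$$ Let $u=(u_I)_{I\in\mathcal D}\in f_p^q$, $u\neq0$, with atomic decomposition $(u_i,\mathcal G_i,I_i)_{i\in\mathcal N}$, and let $\omega=(\omega_I)_{I\in\mathcal D}\in\ell^1(\mathcal D)$ be the weight $$\omega_I=\frac{1}{A_{\frac{2p}{q}}}\,\frac{|I_i|^{1-\frac pq}}{\|u_i\|_{f_q^q}^{q-p}}\,\frac{|u_I|^q|I|}{\|u\|_{f_p^q}^p},\qquad I\in\mathcal G_i,\ i\in\mathcal N$$ (with $\omega_I:=0$ whenever $u_I=0$). Define $y=(y_I)_{I\in\mathcal D}$ and $x=(x_I)_{I\in\mathcal D}$ by $$y_I=\Big(\frac{\omega_I}{|I|}\Big)^{\frac1q},\qquad x_I=\big(|u_I|\,|y_I|^{-\theta}\big)^{\frac1{1-\theta}}$$ (with $x_I:=0$ whenever $u_I=0$). Then $y\in f_q^q$, $x\in X_0$, and there is a constant $C_{p,q}$ depending only on $p,q$ such that $$|u|=|x|^{1-\theta}|y|^\theta\qquad\text{and}\qquad\|x\|_{X_0}^{1-\theta}\,\|y\|_{f_q^q}^\theta\le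 C_{p,q}\|u\|_{f_p^q},$$ where absolute values, powers and products of sequences are taken coordinatewise.
   Context: Dyadic intervals: $\mathcal D$ is the set of all intervals $\left[\frac{k-1}{2^n},\frac{k}{2^n}\right)$ with $n\in\mathbb N_0$, $1\le k\le 2^n$; $|I|$ is the length of $I$. $\ell^1(\mathcal D)$ is the space of absolutely summable real sequences indexed by $\mathcal D$. The Haar function $h_I$ is $1$ on the left half of $I$, $-1$ on the right half, $0$ elsewhere. Discrete Triebel-Lizorkin spaces: for $0<p\le q<\infty$ and a real sequence $f=(x_I)_{I\in\mathcal D}$ put $S_q(f)(t)=\big(\sum_{I\in\mathcal D}|x_I|^q1_I(t)\big)^{1/q}$, $t\in[0,1]$, and $\|f\|_{f_p^q}=\|S_q(f)\|_{L^p([0,1])}$; $f_p^q$ is the set of $f$ with $\|f\|_{f_p^q}<\infty$. Hardy spaces: for $0<p\le2$, a real sequence $f=(x_I)_{I\in\mathcal D}$ is identified with its formal Haar series $\sum_I x_Ih_I$; $S(f)=S_2(f)$, $\|f\|_{H^p}=\|S(f)\|_{L^p([0,1])}$, and $H^p=\{f:\|f\|_{H^p}<\infty\}$. Blocks: a collection $\mathcal C\subseteq\mathcal D$ is a block of dyadic intervals if it has a unique maximal interval $I$ (with respect to inclusion) and, whenever $J\in\mathcal C$, $K\in\mathcal D$ and $J\subseteq K\subseteq I$, then $K\in\mathcal C$. The Carleson constant of a non-empty $\mathcal E\subseteq\mathcal D$ is $\llbracket\mathcal E\rrbracket=\sup_{I\in\mathcal E}\frac1{|I|}\sum_{J\in\mathcal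 E,\,J\subseteq I}|J|$. Atomic decomposition in $H^p$ (known result): for every $0<p\le2$ there is a constant $A_p$, depending only on $p$ and fixed once and for all, such that every $v=\sum_{J\in\mathcal D} v_Jh_J\in H^p$ admits an atomic decomposition $(v_i,\mathcal G_i,I_i)_{i\in\mathcal N}$, i.e. an index set $\mathcal N\subseteq\mathbb N$ and blocks of dyadic intervals $(\mathcal G_i)_{i\in\mathcal N}$ such that, with $v_i=\sum_{J\in\mathcal G_i}v_Jh_J$: (i) $(\mathcal G_i)_{i\in\mathcal N}$ is a disjoint partition of $\mathcal D$; (ii) $I_i:=\bigcup_{J\in\mathcal G_i}J$ is a dyadic interval and $\mathcal E:=\{I_i:i\in\mathcal N\}$ satisfies $\llbracket\mathcal E\rrbracket\le4$; (iii) $\|v\|_{H^p}^p\le\sum_{i\in\mathcal N}\|v_i\|_{H^p}^p\le\sum_{i\in\mathcal N}|I_i|\,\|S(v_i)\|_\infty^p\le A_p\|v\|_{H^p}^p$. Atomic decomposition in $f_p^q$: if $u=(u_I)_{I\in\mathcal D}\in f_p^q$, then $|u|^{q/2}:=(|u_I|^{q/2})_{I\in\mathcal D}\in H^{2p/q}$ with $2p/q\in(0,2]$. If $|u|^{q/2}$ has an atomic decomposition in $H^{2p/q}$ with blocks $\mathcal G_i$ and intervals $I_i$ ($i\in\mathcal N$), then $(u_i,\mathcal G_i,I_i)_{i\in\mathcal N}$, where $u_i=(u_I)_{I\in\mathcal G_i}$ (extended by $0$ outside $\mathcal G_i$), is called an atomic decomposition of $u\in f_p^q$. That $X_0$ with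 $\|\cdot\|_{X_0}$ is a Banach lattice is a known theorem of Pisier. *)

(* Defs.v *)
From HB Require Import structures.
From mathcomp Require Import all_boot all_order all_algebra.
From mathcomp Require Import all_classical all_reals all_analysis.

Set Implicit Arguments.
Unset Strict Implicit.
Unset Printing Implicit Defensive.

Import Order.TTheory GRing.Theory Num.Theory.
Import numFieldNormedType.Exports.

Local Open Scope classical_set_scope.
Local Open Scope ring_scope.

(* The pair (n, k), with k < 2 ^ n, encodes [k / 2 ^ n, (k + 1) / 2 ^ n); the
   encoding is injective, so equality of codes is equality of intervals. *)
Definition dyadic : Type := {n : nat & 'I_(2 ^ n)}.

Definition dlen (R : realType) (I : dyadic) : R := 2%:R ^- tag I.

Definition dint (R : realType) (I : dyadic) : set R :=
  `[(nat_of_ord (tagged I))%:R * dlen R I,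
    (nat_of_ord (tagged I)).+1%:R * dlen R I[%classic.
Arguments dint R I : clear implicits.

(* Inclusion of dyadic intervals. *)
Definition dsub (R : realType) (I J : dyadic) : Prop := dint R I `<=` dint R J.

Definition mu01 (R : realType) : {measure set (measurableTypeR R) -> \bar R} :=
  mrestr (@lebesgue_measure R) (measurable_itv `[0 : R, 1 : R]).

(* A formal Haar series is identified with its sequence of coefficients. Square
   functions and (quasi-)norms are [\bar R]-valued, so that they make sense for
   every sequence. *)
Definition square_fun (R : realType) (q : R) (x : dyadic -> R) (t : R) : \bar R :=
  poweR (\esum_(I in [set: dyadic]) (`|x I| `^ q * \1_(dint R I) t)%:E) q^-1.

Definition fnorm (R : realType) (p q : R) (x : dyadic -> R) : \bar R :=
  Lnorm (@mu01 R) p%:E (square_fun q x).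

Definition in_f (R : realType) (p q : R) (x : dyadic -> R) : Prop :=
  (fnorm p q x < +oo)%E.

Definition hardy_norm (R : realType) (p : R) (v : dyadic -> R) : \bar R :=
  Lnorm (@mu01 R) p%:E (square_fun 2%:R v).

Definition in_hardy (R : realType) (p : R) (v : dyadic -> R) : Prop :=
  (hardy_norm p v < +oo)%E.

Definition maximal_in (R : realType) (C : set dyadic) (I : dyadic) : Prop :=
  C I /\ forall J, C J -> dsub R I J -> J = I.

Definition is_block (R : realType) (C : set dyadic) : Prop :=
  exists I, [/\ maximal_in R C I,
    forall I', maximal_in R C I' -> I' = I &
    forall J K, C J -> dsub R J K -> dsub R K I -> C K].

Definition carleson (R : realType) (E : set dyadic) : \bar R :=
  ereal_sup [set ((dlen R I)^-1%:E *
                  \esum_(J in E `&` [set J | dsub R J I]) (dlen R J)%:E)%E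
            | I in E].

Definition restr (R : realType) (G : set dyadic) (v : dyadic -> R) : dyadic -> R :=
  patch (fun=> 0) G v.

(* [A] is the constant in the last estimate; outside [N] the values of the
   families [G] and [I] are irrelevant. *)
Record atomic_decomposition (R : realType) (p A : R) (v : dyadic -> R)
    (N : set nat) (G : nat -> set dyadic) (I : nat -> dyadic) : Prop := {
  atomic_block : forall i, N i -> is_block R (G i) ;
  atomic_disjoint : trivIset N G ;
  atomic_cover : \bigcup_(i in N) G i = [set: dyadic] ;
  atomic_union : forall i, N i -> dint R (I i) = \bigcup_(J in G i) dint R J ;
  atomic_carleson : (carleson R [set I i | i in N] <= 4%:E)%E ;
  atomic_lower : (poweR (hardy_norm p v) p
    <= \esum_(i in N) poweR (hardy_norm p (restr (G i) v)) p)%E ;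
  atomic_middle : (\esum_(i in N) poweR (hardy_norm p (restr (G i) v)) p
    <= \esum_(i in N) ((dlen R (I i))%:E *
         poweR (Lnorm (@mu01 R) +oo (square_fun 2%:R (restr (G i) v))) p))%E ;
  atomic_upper : (\esum_(i in N) ((dlen R (I i))%:E *
         poweR (Lnorm (@mu01 R) +oo (square_fun 2%:R (restr (G i) v))) p)
    <= A%:E * poweR (hardy_norm p v) p)%E }.

Definition atomic_constants (R : realType) (A : R -> R) : Prop :=
  forall r : R, 0 < r <= 2%:R -> forall v : dyadic -> R, in_hardy r v ->
  exists (N : set nat) (G : nat -> set dyadic) (I : nat -> dyadic),
    atomic_decomposition r (A r) v N G I.

Definition f_atomic_decomposition (R : realType) (A : R -> R) (p q : R)
    (u : dyadic -> R) (N : set nat) (G : nat -> set dyadic) (I : nat -> dyadic) :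
    Prop :=
  atomic_decomposition (2%:R * p / q) (A (2%:R * p / q))
    (fun J => `|u J| `^ (q / 2%:R)) N G I.

Definition theta (R : realType) (p q : R) : R := q / (q - 1) * ((p - 1) / p).

Definition X0_norm (R : realType) (p q : R) (x : dyadic -> R) : \bar R :=
  ereal_sup
    [set poweR (fnorm p q (fun I => `|x I| `^ (1 - theta p q)
                                    * `|y I| `^ theta p q))
               (1 - theta p q)^-1
    | y in [set y : dyadic -> R | in_f q q y /\ (fnorm q q y <= 1)%E]].

Definition in_X0 (R : realType) (p q : R) (x : dyadic -> R) : Prop :=
  (X0_norm p q x < +oo)%E.

(* The value of the weight at [J], a member of the block [G] with union [I].
   The [fine]s are harmless: the norm of [u] is finite when [u] is in f_p^q, and
   for an atomic decomposition of [u] the last estimate bounds the square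
   function of each [restr G u] essentially, so that its norm is finite too. *)
Definition weight (R : realType) (A : R -> R) (p q : R) (u : dyadic -> R)
    (G : set dyadic) (I J : dyadic) : R :=
  if u J == 0 then 0 else
    (A (2%:R * p / q))^-1
    * (dlen R I `^ (1 - p / q) / fine (fnorm q q (restr G u)) `^ (q - p))
    * (`|u J| `^ q * dlen R J / fine (fnorm p q u) `^ p).

Definition y_of (R : realType) (q : R) (omega : dyadic -> R) (I : dyadic) : R :=
  (omega I / dlen R I) `^ q^-1.

Definition x_of (R : realType) (p q : R) (u y : dyadic -> R) (I : dyadic) : R :=
  if u I == 0 then 0 else
    (`|u I| * `|y I| `^ (- theta p q)) `^ (1 - theta p q)^-1.

(* Main.v *)
(* Write s = p / q, K = A_{2p/q} ||u||^p, and let m_i be the mean over I_i of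
   the sum of |u_J|^q 1_J, J in G_i.  The essential suprema of the atomic
   decomposition dominate these means, so the sum of m_i^s |I_i| is at most K,
   and the weight is omega_J = m_i^(s-1) |u_J|^q |J| / K on G_i; hence ||omega||_1 <= 1.
   For z in the unit ball of f_q^q let T_i be the part over G_i of the q-th power
   of the square function of |x|^(1-theta) |z|^theta. Since t^theta <= 1 + t,
   m_i^(s-1) T_i is bounded by the sum over G_i of
   (m_i^(s-1) |u_J|^q + K |z_J|^q) 1_J, and in the same way
   T_i^s <= m_i^s + m_i^(s-1) T_i on I_i.  As t^s is subadditive, integrating and
   summing over i bounds the p-th power of the norm by 3K, so that
   C = (3 A_{2p/q})^(1/p) works. *)

Require Import Defs.
From mathcomp Require Import all_boot all_order all_algebra.
From mathcomp Require Import all_classical all_reals all_analysis.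
From mathcomp Require Import measurable_realfun ess_sup_inf ring.

Set Implicit Arguments.
Unset Strict Implicit.
Unset Printing Implicit Defensive.

Import Order.TTheory GRing.Theory Num.Theory.
Import numFieldNormedType.Exports.

Local Open Scope classical_set_scope.
Local Open Scope ring_scope.

(** * Unordered sums over a countable type, and their integrals *)

Section countable_esum.
Local Open Scope ereal_scope.
Context d (T : measurableType d) (R : realType) (I : countType).

(** Re-indexing along the injection [pickle], with value 0 at the naturals that are not codes, makes
    series results such as monotone convergence available. *)
Lemma esum_countable (a : I -> \bar R) : (forall i, 0 <= a i) ->
  \esum_(i in [set: I]) a i = \sum_(n <oo) oapp a 0 (pickle_inv n).
Proof.
move=> a0; rewrite nneseries_esumT; last by move=> n; case: pickle_inv => //=.
have -> : \esum_(i in [set: I]) a i =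
    \esum_(i in [set: I]) oapp a 0 (pickle_inv (pickle i)).
  by apply: eq_esum => i _; rewrite pickleK_inv.
rewrite -(@esum_image R I nat [set: I] pickle (fun n => oapp a 0 (pickle_inv n))).
  rewrite esum_mkcond; apply: eq_esum => n _; case: ifPn => // /negP nP.
  have := @pickle_invK I n; case: (pickle_inv n) => //= i iE.
  by case: nP; apply/mem_set; exists i.
by move=> i j _ _; exact: (pcan_inj pickleK).
Qed.

Lemma esumZl (D : set I) (a : I -> \bar R) (c : R) : (0 <= c)%R ->
  (forall i, 0 <= a i) ->
  \esum_(i in D) (c%:E * a i) = c%:E * \esum_(i in D) a i.
Proof.
move=> c0 a0; rewrite [LHS]esum_mkcond [in RHS]esum_mkcond !esum_countable.
- rewrite -nneseriesZl; last by move=> n _; case: pickle_inv => //= i; case: ifP.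
  apply: eq_eseriesr => n _; case: pickle_inv => [i|]/=; last by rewrite mule0.
  by case: ifP; rewrite ?mule0.
- by move=> i; case: ifP.
- by move=> i; case: ifP => // _; rewrite mule_ge0.
Qed.

Variables (mu : {measure set T -> \bar R}) (D : set I) (f : I -> T -> \bar R).
Hypotheses (mf : forall i, measurable_fun [set: T] (f i))
  (f0 : forall i t, 0 <= f i t).

Let g (n : nat) (t : T) :=
  oapp (fun i => if i \in D then f i t else 0) 0 (@pickle_inv I n).

Let g0 n t : 0 <= g n t.
Proof. by rewrite /g; case: pickle_inv => //= i; case: ifP. Qed.

Let mg n : measurable_fun [set: T] (g n).
Proof.
rewrite /g; case: pickle_inv => [i|]/=; last exact: measurable_cst.
by case: (i \in D); [exact: mf|exact: measurable_cst].
Qed.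

Let esumg t : \esum_(i in D) f i t = \sum_(n <oo) g n t.
Proof.
by rewrite esum_mkcond esum_countable// => i; case: ifP.
Qed.

Lemma ge0_measurable_esum :
  measurable_fun [set: T] (fun t => \esum_(i in D) f i t).
Proof.
have -> : (fun t => \esum_(i in D) f i t) = (fun t => \sum_(n <oo) g n t).
  by apply/funext => t; exact: esumg.
by apply: ge0_emeasurable_sum => // n t _ _; exact: g0.
Qed.

Lemma ge0_integral_esum :
  \int[mu]_t (\esum_(i in D) f i t) = \esum_(i in D) (\int[mu]_t f i t).
Proof.
under eq_integral do rewrite esumg.
rewrite integral_nneseries//.
rewrite [RHS]esum_mkcond esum_countable.
  apply: eq_eseriesr => n _; rewrite /g; case: pickle_inv => [i|]/=.
    by case: (i \in D) => //; rewrite integral0.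
  by rewrite integral0.
by move=> i; case: (i \in D) => //; exact: integral_ge0.
Qed.

End countable_esum.

(** * Inequalities for powers with exponent in (0, 1] *)

Section powers.
Context {R : realType}.

Lemma powR_le1D (t s : R) : 0 <= t -> 0 <= s <= 1 -> t `^ s <= 1 + t.
Proof.
move=> t0 /andP[s0 s1]; case: (leP t 1) => t1.
  apply: (@le_trans _ _ (1 `^ s)).
    by apply: ge0_ler_powR => //; rewrite nnegrE.
  by rewrite powR1 lerDl.
apply: (le_trans (ler1_powR (ltW t1) s1)); rewrite lerDr; exact: ler01.
Qed.

(* Homogeneous form of t^s <= 1 + t, at t = a / m. *)
Lemma poweR_leD (m s : R) (a : \bar R) : 0 < m -> 0 < s <= 1 -> (0 <= a)%E ->
  (poweR a s <= (m `^ s)%:E + (m `^ (s - 1))%:E * a)%E.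
Proof.
move=> m0 /andP[s0 s1]; case: a => [a||]// a0.
  rewrite poweR_EFin -EFinM -EFinD lee_fin.
  have m1 := powR_gt0 s m0.
  have -> : m `^ s + m `^ (s - 1) * a = m `^ s * (1 + a / m).
    rewrite powRB ?(gt_eqF m0) ?implybT// powRr1 ?(ltW m0)//; field.
    by rewrite gt_eqF.
  have am : 0 <= a / m by rewrite divr_ge0// ltW.
  rewrite -{1}(divfK (lt0r_neq0 m0) a) powRM ?(ltW m0)// mulrC ler_pM2l//.
  by apply: powR_le1D; rewrite // (ltW s0).
rewrite gt0_muley ?lte_fin ?powR_gt0// addey//; exact: leey.
Qed.

Lemma powRD_le (a b s : R) : 0 <= a -> 0 <= b -> 0 < s <= 1 ->
  (a + b) `^ s <= a `^ s + b `^ s.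
Proof.
move=> a0 b0 /andP[s0 s1].
have [->|an0] := eqVneq a 0; first by rewrite add0r lerDr powR_ge0.
have [->|bn0] := eqVneq b 0; first by rewrite addr0 lerDl powR_ge0.
have ap : 0 < a by rewrite lt_def an0.
have bp : 0 < b by rewrite lt_def bn0.
have cp : 0 < a + b by rewrite addr_gt0.
have H x : 0 < x -> x <= a + b -> x / (a + b) * (a + b) `^ s <= x `^ s.
  move=> xp xl; have -> : x `^ s = (x / (a + b)) `^ s * (a + b) `^ s.
    by rewrite -powRM ?divfK ?divr_ge0 ?gt_eqF// ltW.
  rewrite ler_pM2r ?powR_gt0//; apply: ger1_powR => //.
  by rewrite divr_gt0//= ler_pdivrMr// mul1r.
have := lerD (H _ ap _) (H _ bp _); rewrite lerDl lerDr => /(_ b0 a0).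
by rewrite -mulrDl -mulrDl divff ?mul1r// gt_eqF.
Qed.

Lemma poweRD_le (a b : \bar R) (s : R) : (0 <= a)%E -> (0 <= b)%E ->
  0 < s <= 1 -> (poweR (a + b) s <= poweR a s + poweR b s)%E.
Proof.
case: a b => [a||] [b||]// a0 b0 s01; have /andP[s0 _] := s01.
- by rewrite -EFinD !poweR_EFin -EFinD lee_fin powRD_le.
- by rewrite addey// poweRyr ?gt_eqF// addey ?leey//.
- by rewrite addye// poweRyr ?gt_eqF// addye ?leey//.
- by rewrite addye// poweRyr ?gt_eqF// addye ?leey//.
Qed.

Lemma poweR_sum_le (T : choiceType) (r : seq T) (a : T -> \bar R) (s : R) :
  (forall i, 0 <= a i)%E -> 0 < s <= 1 ->
  (poweR (\sum_(i <- r) a i) s <= \sum_(i <- r) poweR (a i) s)%E.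
Proof.
move=> a0 s01; elim: r => [|i r IH].
  by rewrite !big_nil poweR0r// gt_eqF//; case/andP: s01.
rewrite !big_cons; apply: le_trans (poweRD_le _ _ s01) _ => //.
  exact: sume_ge0.
exact: leeD.
Qed.

Lemma poweR_esum_le (T : choiceType) (D : set T) (a : T -> \bar R) (s : R) :
  (forall i, 0 <= a i)%E -> 0 < s <= 1 ->
  (poweR (\esum_(i in D) a i) s <= \esum_(i in D) poweR (a i) s)%E.
Proof.
move=> a0 s01; have /andP[s0 _] := s01.
set B := (\esum_(i in D) poweR _ _)%E.
have B0 : (0 <= B)%E by apply: esum_ge0 => i _; exact: poweR_ge0.
(* Moving the power to the right leaves a bare supremum on the left, so it is enough to bound every
   finite partial sum. *)
suff le : (\esum_(i in D) a i <= poweR B s^-1)%E.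
  rewrite -[leRHS](poweRe1 B0) -(mulVf (lt0r_neq0 s0)) poweRrM.
  apply: gt0_ler_poweR => //; rewrite ?in_itv/= ?leey ?andbT ?poweR_ge0//.
    exact: ltW.
  exact: esum_ge0.
apply: ge_ereal_sup => _ [X [finX XD] <-].
set S := (\sum_(i \in X) a i)%E.
have S0 : (0 <= S)%E by apply: fsume_ge0.
rewrite -[S](poweRe1 S0) -(mulfV (lt0r_neq0 s0)) poweRrM.
apply: gt0_ler_poweR; rewrite ?in_itv/= ?leey ?andbT ?poweR_ge0//.
  by rewrite invr_ge0 ltW.
rewrite /S fsbig_finite//; apply: (le_trans (poweR_sum_le _ a0 s01)).
by apply: esum_ge; exists X => //; rewrite fsbig_finite.
Qed.

End powers.

(** * Weighted sums of indicators of dyadic intervals and their integrals *)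

Section dyadic_integrals.
Context {R : realType}.
Implicit Types (J : dyadic) (D : set dyadic) (a : dyadic -> R).

Lemma dlen_gt0 J : 0 < dlen R J.
Proof. by rewrite /dlen invr_gt0 exprn_gt0. Qed.

Lemma measurable_dint J : measurable (dint R J).
Proof. exact: measurable_itv. Qed.

(** Restricting to [0, 1] loses no mass: [k < 2 ^ n] keeps the right endpoint at most 1. *)
Lemma mu01_dint J : mu01 R (dint R J) = (dlen R J)%:E.
Proof.
have l0 := dlen_gt0 J.
rewrite /mu01 /= /mrestr setIidl.
  rewrite lebesgue_measure_itv/= lte_fin ltr_pM2r// ltr_nat ltnSn.
  by rewrite -EFinB -mulrBl -natrB ?subSnn ?mul1r.
move=> t; rewrite /dint /= !in_itv/= => /andP[t0 t1].
rewrite (le_trans _ t0)/= ?mulr_ge0 ?(ltW l0)//.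
apply: (le_trans (ltW t1)).
rewrite /dlen ler_pdivrMr ?exprn_gt0// mul1r.
by rewrite -natrX ler_nat; case: (tagged J).
Qed.

Lemma mu01_setT : mu01 R [set: measurableTypeR R] = 1%E.
Proof.
rewrite /mu01 /= /mrestr setTI lebesgue_measure_itv/= lte_fin ltr01.
by rewrite -EFinB subr0.
Qed.

(** For [a = |x|^q] this is the [q]-th power of the square function of [x] restricted to [D]; no
    root is taken, so it is additive in [D] and [a]. *)
Definition dyadic_sum D a (t : measurableTypeR R) : \bar R :=
  (\esum_(J in D) (a J * \1_(dint R J) t)%:E)%E.

(** The integral of [dyadic_sum D a]; for [a = |x|^q] it is the [q]-th power of the f_q^q norm of
    [x] restricted to [D]. *)
Definition dyadic_mass D a : \bar R := (\esum_(J in D) (a J * dlen R J)%:E)%E.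

Lemma measurable_dyadic_term (c : R) J :
  measurable_fun [set: measurableTypeR R] (fun t => (c * \1_(dint R J) t)%:E).
Proof.
apply/measurable_EFinP; apply: measurable_funM => //.
exact: measurable_indic (measurable_dint J).
Qed.

Lemma integral_dyadic_term (c : R) J : 0 <= c ->
  (\int[mu01 R]_t (c * \1_(dint R J) t)%:E = (c * dlen R J)%:E)%E.
Proof.
move=> c0; under eq_integral do rewrite EFinM.
rewrite ge0_integralZl_EFin//; last first.
  apply/measurable_EFinP; exact: measurable_indic (measurable_dint J).
rewrite integral_indic//; last exact: measurable_dint.
by rewrite setIT mu01_dint.
Qed.

Lemma dyadic_term_ge0 (c : R) J (t : R) :
  0 <= c -> (0 <= (c * \1_(dint R J) t)%:E)%E.
Proof. by move=> c0; rewrite lee_fin mulr_ge0. Qed.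

Lemma dyadic_sum_ge0 D a t : (forall J, 0 <= a J) -> (0 <= dyadic_sum D a t)%E.
Proof. by move=> a0; apply: esum_ge0 => J _; exact: dyadic_term_ge0. Qed.

Lemma dyadic_mass_ge0 D a : (forall J, 0 <= a J) -> (0 <= dyadic_mass D a)%E.
Proof.
by move=> a0; apply: esum_ge0 => J _; rewrite lee_fin mulr_ge0// ltW// dlen_gt0.
Qed.

Lemma measurable_dyadic_sum D a : (forall J, 0 <= a J) ->
  measurable_fun [set: measurableTypeR R] (dyadic_sum D a).
Proof.
move=> a0; apply: ge0_measurable_esum => [J|J t].
  exact: measurable_dyadic_term.
exact: dyadic_term_ge0.
Qed.

Lemma integral_dyadic_sum D a : (forall J, 0 <= a J) ->
  (\int[mu01 R]_t dyadic_sum D a t = dyadic_mass D a)%E.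
Proof.
move=> a0; rewrite /dyadic_sum ge0_integral_esum.
- by apply: eq_esum => J _; rewrite integral_dyadic_term.
- by move=> J; exact: measurable_dyadic_term.
- by move=> J t; exact: dyadic_term_ge0.
Qed.

Lemma dyadic_massZl D a c : 0 <= c -> (forall J, 0 <= a J) ->
  dyadic_mass D (fun J => c * a J) = (c%:E * dyadic_mass D a)%E.
Proof.
move=> c0 a0; rewrite /dyadic_mass -esumZl//.
  by apply: eq_esum => J _; rewrite -mulrA EFinM.
by move=> J; rewrite lee_fin mulr_ge0// ltW// dlen_gt0.
Qed.

Lemma esum_bigcup_in (T : choiceType) (N : set nat) (G : nat -> set T)
    (a : T -> \bar R) : trivIset N G -> (forall x, 0 <= a x)%E ->
  (\esum_(x in \bigcup_(i in N) G i) a x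
    = \esum_(i in N) \esum_(x in G i) a x)%E.
Proof.
(* Disjointness is known only on [N]; emptying the other sets extends it to all indices. *)
move=> tG a0; pose G' i := if i \in N then G i else set0.
have -> : \bigcup_(i in N) G i = \bigcup_(i in N) G' i.
  by apply: eq_bigcupr => i Ni; rewrite /G' mem_set.
rewrite esum_bigcupT//.
  by apply: eq_esum => i Ni; rewrite /G' mem_set.
apply/trivIsetP => i j _ _ ij; rewrite /G'.
case: ifPn => iN; case: ifPn => jN; rewrite ?set0I ?setI0//.
by move/trivIsetP : tG; apply => //; exact/set_mem.
Qed.

End dyadic_integrals.

(** * Norms in terms of dyadic sums and masses, and splitting over blocks *)

Section norms.
Context {R : realType}.
Implicit Types (D : set dyadic) (x : dyadic -> R).

Lemma dyadic_sum_restr D x (q : R) t : q != 0 ->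
  dyadic_sum [set: dyadic] (fun J => `|restr D x J| `^ q) t
    = dyadic_sum D (fun J => `|x J| `^ q) t.
Proof.
move=> q0; rewrite /dyadic_sum [RHS]esum_mkcond; apply: eq_esum => J _.
rewrite /restr /patch; case: ifP => // _.
by rewrite normr0 powR0// mul0r.
Qed.

Lemma poweR_fnorm (p q : R) x : 0 < p ->
  (poweR (fnorm p q x) p = \int[mu01 R]_t
    poweR (dyadic_sum [set: dyadic] (fun J => (`|x J| `^ q)%R) t) (p / q))%E.
Proof.
move=> p0; rewrite /fnorm poweR_Lnorm ?gt_eqF//.
apply: eq_integral => t _; rewrite gee0_abs ?poweR_ge0// /square_fun.
by rewrite -poweRrM mulrC.
Qed.

Lemma poweR_fnorm_diag (q : R) x : 0 < q ->
  poweR (fnorm q q x) q = dyadic_mass [set: dyadic] (fun J => `|x J| `^ q).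
Proof.
move=> q0; rewrite poweR_fnorm// divff ?gt_eqF//.
rewrite -integral_dyadic_sum => [|J]; last exact: powR_ge0.
by apply: eq_integral => t _; rewrite poweRe1// dyadic_sum_ge0.
Qed.

Lemma poweR_fnorm_restr (q : R) D x : 0 < q ->
  poweR (fnorm q q (restr D x)) q = dyadic_mass D (fun J => `|x J| `^ q).
Proof.
move=> q0; rewrite poweR_fnorm// divff ?gt_eqF//.
rewrite -integral_dyadic_sum => [|J]; last exact: powR_ge0.
apply: eq_integral => t _; rewrite dyadic_sum_restr ?gt_eqF// poweRe1//.
by rewrite dyadic_sum_ge0// => J; exact: powR_ge0.
Qed.

Lemma fnorm_ge0 (p q : R) x : (0 <= fnorm p q x)%E.
Proof. exact: Lnorm_ge0. Qed.

(** The square of [S_2(|u|^(q/2))] is the [q]-th power of [S_q(u)], so both integrands are the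
    [p]-th power of [S_q(u)]. *)
Lemma poweR_hardy_norm (p q : R) (u : dyadic -> R) : 0 < p -> 0 < q ->
  poweR (hardy_norm (2%:R * p / q) (fun J => `|u J| `^ (q / 2%:R))) (2%:R * p / q)
    = poweR (fnorm p q u) p.
Proof.
move=> p0 q0; rewrite poweR_fnorm//.
rewrite (@poweR_fnorm (2%:R * p / q) 2%:R); last by rewrite divr_gt0// mulr_gt0.
apply: eq_integral => t _; congr (poweR _ _); last by field; rewrite gt_eqF.
apply: eq_esum => J _.
by rewrite ger0_norm ?powR_ge0// -powRrM divfK.
Qed.

(** The sum vanishes off [I], since every [J] in [D] lies in [I], and on [I] it is almost everywhere
    at most the squared essential supremum; integration gives the factor [|I|]. *)
Lemma dyadic_mass_le_esssup D I (a : dyadic -> R) (f : R -> \bar R) :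
  (forall J, 0 <= a J) -> dint R I = \bigcup_(J in D) dint R J ->
  (forall t, dyadic_sum D a t = poweR (f t) 2%:R) -> (forall t, 0 <= f t)%E ->
  (dyadic_mass D a <= (dlen R I)%:E * poweR (Lnorm (mu01 R) +oo f) 2%:R)%E.
Proof.
move=> a0 ID fE f0; set e := Lnorm _ _ _.
have eE : e = ess_sup (mu01 R) (abse \o f).
  (* The norm at [+oo] is an essential supremum only when the total mass is positive. *)
  by rewrite /e unlock mu01_setT lte01.
have e0 : (0 <= e)%E by exact: Lnorm_ge0.
case eq_e : e => [c||]; last 2 first.
- by rewrite poweRyr// gt0_muley ?leey// lte_fin dlen_gt0.
- by move: e0; rewrite eq_e.
have c0 : 0 <= c by move: e0; rewrite eq_e lee_fin.
rewrite poweR_EFin -EFinM mulrC -integral_dyadic_term ?powR_ge0//.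
rewrite -integral_dyadic_sum//.
apply: ae_ge0_le_integral => //.
- by move=> t _; exact: dyadic_sum_ge0.
- exact: measurable_dyadic_sum.
- by move=> t _; apply: dyadic_term_ge0; exact: powR_ge0.
- exact: measurable_dyadic_term.
have := @ess_sup_ge _ _ _ (mu01 R) (abse \o f); rewrite -eE eq_e.
apply: filterS => t /= fc _.
have [tI|tI] := pselect (dint R I t).
  rewrite indicE mem_set// mulr1 fE -poweR_EFin.
  move: fc; rewrite gee0_abs// => fc.
  by apply: gt0_ler_poweR => //; rewrite in_itv/= leey andbT// lee_fin.
rewrite /dyadic_sum esum1; first by apply: dyadic_term_ge0; exact: powR_ge0.
move=> J DJ; rewrite indicE memNset ?mulr0// => tJ.
by apply: tI; rewrite ID; exists J.
Qed.

Lemma dyadic_sum_bigcup (N : set nat) (G : nat -> set dyadic) (a : dyadic -> R) t :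
  trivIset N G -> \bigcup_(i in N) G i = [set: dyadic] -> (forall J, 0 <= a J) ->
  (dyadic_sum [set: dyadic] a t = \esum_(i in N) dyadic_sum (G i) a t)%E.
Proof.
move=> tG <- a0; rewrite /dyadic_sum esum_bigcup_in// => J.
exact: dyadic_term_ge0.
Qed.

Lemma dyadic_mass_bigcup (N : set nat) (G : nat -> set dyadic) (a : dyadic -> R) :
  trivIset N G -> \bigcup_(i in N) G i = [set: dyadic] -> (forall J, 0 <= a J) ->
  (dyadic_mass [set: dyadic] a = \esum_(i in N) dyadic_mass (G i) a)%E.
Proof.
move=> tG <- a0; rewrite /dyadic_mass esum_bigcup_in// => J.
by rewrite lee_fin mulr_ge0// ltW// dlen_gt0.
Qed.

Lemma dyadic_massD D (a b : dyadic -> R) :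
  (forall J, 0 <= a J) -> (forall J, 0 <= b J) ->
  dyadic_mass D (fun J => a J + b J) = (dyadic_mass D a + dyadic_mass D b)%E.
Proof.
move=> a0 b0; rewrite /dyadic_mass -esumD => [|J _|J _].
- by apply: eq_esum => J _; rewrite mulrDl EFinD.
- by rewrite lee_fin mulr_ge0// ltW// dlen_gt0.
- by rewrite lee_fin mulr_ge0// ltW// dlen_gt0.
Qed.

Lemma dyadic_sumZl D (a : dyadic -> R) c t : 0 <= c -> (forall J, 0 <= a J) ->
  dyadic_sum D (fun J => c * a J) t = (c%:E * dyadic_sum D a t)%E.
Proof.
move=> c0 a0; rewrite /dyadic_sum -esumZl//.
  by apply: eq_esum => J _; rewrite -mulrA EFinM.
by move=> J; exact: dyadic_term_ge0.
Qed.

(** * The integral estimate over a partition into blocks *)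

Section block_estimate.
Variables (N : set nat) (G : nat -> set dyadic) (I : nat -> dyadic).
(* [a] and [b] stand for |u|^q and |z|^q, [w] for the q-th power of
   |x|^(1-theta) |z|^theta. *)
Variables (a b w : dyadic -> R) (m : nat -> R) (K s : R).
Hypotheses (tG : trivIset N G) (cG : \bigcup_(i in N) G i = [set: dyadic])
  (IG : forall i, N i -> dint R (I i) = \bigcup_(J in G i) dint R J).
Hypotheses (a0 : forall J, 0 <= a J) (b0 : forall J, 0 <= b J)
  (w0 : forall J, 0 <= w J) (m0 : forall i, 0 <= m i) (K0 : 0 <= K)
  (s01 : 0 < s <= 1).
Hypotheses
  (ma : forall i, N i -> dyadic_mass (G i) a = (m i * dlen R (I i))%:E)
  (mK : (\esum_(i in N) (m i `^ s * dlen R (I i))%:E <= K%:E)%E)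
  (b1 : (dyadic_mass [set: dyadic] b <= 1)%E)
  (wab : forall i J, N i -> G i J ->
    m i `^ (s - 1) * w J <= m i `^ (s - 1) * a J + K * b J)
  (wm0 : forall i J, N i -> G i J -> m i = 0 -> w J = 0).

Let c i J := m i `^ (s - 1) * a J + K * b J.
Let c0 i J : 0 <= c i J.
Proof. by rewrite addr_ge0// mulr_ge0// powR_ge0. Qed.

(** Integrable majorant of the contribution of block [i]: the term [m^s] from [poweR_leD], and the
    bound [wab] summed over the block. *)
Let g i t : \bar R :=
  ((m i `^ s * \1_(dint R (I i)) t)%:E + dyadic_sum (G i) (c i) t)%E.
Let g0 i t : (0 <= g i t)%E.
Proof. by rewrite adde_ge0 ?dyadic_sum_ge0// dyadic_term_ge0// powR_ge0. Qed.
Let mg i : measurable_fun [set: measurableTypeR R] (g i).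
Proof.
apply: emeasurable_funD; first exact: measurable_dyadic_term.
exact: measurable_dyadic_sum.
Qed.

Let wg i t : N i -> (poweR (dyadic_sum (G i) w t) s <= g i t)%E.
Proof.
move=> Ni; have /andP[s0 _] := s01.
(* Off [I i] all indicators vanish, and if [m i = 0] all coefficients do by [wm0]; otherwise
   [poweR_leD] applies with [m i] as the positive scale. *)
suff [->|[tI mi0]] : dyadic_sum (G i) w t = 0%E \/ dint R (I i) t /\ 0 < m i.
- by rewrite poweR0r ?gt_eqF.
- apply: le_trans (poweR_leD mi0 s01 (dyadic_sum_ge0 _ _ w0)) _.
  rewrite /g indicE mem_set// mulr1 leeD2l// -dyadic_sumZl ?powR_ge0//.
  apply: le_esum => J GJ; rewrite lee_fin ler_wpM2r//; exact: wab.
have [tI|tI] := pselect (dint R (I i) t); last first.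
  left; apply: esum1 => J GJ; rewrite indicE memNset ?mulr0// => tJ.
  by apply: tI; rewrite IG//; exists J.
have [mi0|mi0] := eqVneq (m i) 0; last by right; rewrite lt_def mi0 m0.
by left; apply: esum1 => J GJ; rewrite (wm0 Ni GJ)// mul0r.
Qed.

(** Subadditivity of [t^s] reduces the integrand to the sum of the majorants [g i], which is
    integrated term by term. *)
Lemma integral_dyadic_sum_le :
  (\int[mu01 R]_t poweR (dyadic_sum [set: dyadic] w t) s <= (3%:R * K)%:E)%E.
Proof.
have /andP[s0 _] := s01.
have mw : measurable_fun [set: measurableTypeR R]
    (fun t => poweR (dyadic_sum [set: dyadic] w t) s).
  exact: (measurableT_comp (measurable_poweR s)
            (measurable_dyadic_sum [set: dyadic] w0)).
apply: (@le_trans _ _ (\int[mu01 R]_t \esum_(i in N) g i t)%E).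
  apply: ge0_le_integral => //.
  - by move=> t _; exact: poweR_ge0.
  - exact: ge0_measurable_esum.
  move=> t _; rewrite (dyadic_sum_bigcup _ tG cG w0).
  apply: le_trans (poweR_esum_le _ _ s01) _.
    by move=> i; exact: dyadic_sum_ge0.
  by apply: le_esum => i Ni; exact: wg.
rewrite ge0_integral_esum//.
have gE i : N i -> (\int[mu01 R]_t g i t = (m i `^ s * dlen R (I i))%:E
    + (m i `^ s * dlen R (I i))%:E + K%:E * dyadic_mass (G i) b)%E.
  move=> Ni; rewrite ge0_integralD//; first last.
  - exact: measurable_dyadic_sum.
  - by move=> t _; exact: dyadic_sum_ge0.
  - exact: measurable_dyadic_term.
  - by move=> t _; apply: dyadic_term_ge0; exact: powR_ge0.
  rewrite integral_dyadic_term ?powR_ge0// integral_dyadic_sum//.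
  rewrite /c dyadic_massD; last 2 first.
  - by move=> J; rewrite mulr_ge0// powR_ge0.
  - by move=> J; rewrite mulr_ge0.
  rewrite !dyadic_massZl ?powR_ge0// ma// -EFinM mulrA.
  (* By [ma] the part with [a] integrates to [m^(s-1) * m * |I|], a second copy of [m^s * |I|]. *)
  by rewrite [_ `^ _ * m i]mulrC mulr_powRB1// addeA.
have d0 i : N i -> (0 <= (m i `^ s * dlen R (I i))%:E)%E.
  by move=> _; rewrite lee_fin mulr_ge0 ?powR_ge0// ltW// dlen_gt0.
have e0 i : N i -> (0 <= K%:E * dyadic_mass (G i) b)%E.
  by move=> _; rewrite mule_ge0// dyadic_mass_ge0.
have dd0 i : N i -> (0 <= (m i `^ s * dlen R (I i))%:E
    + (m i `^ s * dlen R (I i))%:E)%E by move=> Ni; rewrite adde_ge0// d0.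
rewrite (eq_esum gE) (esumD dd0 e0) (esumD d0 d0).
rewrite esumZl// => [|i]; last exact: dyadic_mass_ge0.
rewrite -dyadic_mass_bigcup//.
(* Two copies of [K] come from [mK], the third from the total mass of [b] being at most 1. *)
have -> : 3%:R * K = K + K + K * 1 by ring.
rewrite !EFinD EFinM !leeD// lee_pmul//; exact: dyadic_mass_ge0.
Qed.

End block_estimate.

End norms.

(** * The range of theta, and block means from an atomic decomposition *)

Section atomic_data.
Context {R : realType}.

Lemma le_poweRV (p : R) (X Y : \bar R) : 0 < p -> (0 <= X)%E -> (0 <= Y)%E ->
  (poweR X p <= Y)%E -> (X <= poweR Y p^-1)%E.
Proof.
move=> p0 X0 Y0 XY; rewrite -[X]poweRe1// -(mulfV (lt0r_neq0 p0)) poweRrM.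
apply: gt0_ler_poweR; rewrite ?in_itv/= ?leey ?andbT ?poweR_ge0//.
by rewrite invr_ge0 ltW.
Qed.

Lemma dyadic_mass_ge (D : set dyadic) (a : dyadic -> R) J : D J ->
  ((a J * dlen R J)%:E <= dyadic_mass D a)%E.
Proof.
move=> DJ; apply: esum_ge; exists [set J]; last by rewrite fsbig_set1.
by split=> // j ->.
Qed.

Lemma theta_itv (p q : R) : 1 < p -> p < q -> 0 < theta p q < 1.
Proof.
move=> p1 pq; have p0 : 0 < p by apply: lt_trans p1.
have q0 : 0 < q by apply: lt_trans pq.
have q1 : 0 < q - 1 by rewrite subr_gt0 (lt_trans p1).
apply/andP; split; first by rewrite mulr_gt0 ?divr_gt0 ?(subr_gt0 1 p).
rewrite /theta mulf_div ltr_pdivrMr ?mulr_gt0// mul1r -subr_gt0.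
(* After clearing denominators, [theta < 1] is exactly [p < q]. *)
have -> : (q - 1) * p - q * (p - 1) = q - p by ring.
by rewrite subr_gt0.
Qed.

(** The mean over [I i] of the block part of [S_q(u)^q] is at most the squared essential supremum of
    the square function of the atom of [|u|^(q/2)]; its power [p / q] is then controlled by the last
    estimate of the decomposition. *)
Lemma atomic_mean (A : R -> R) (p q : R) (u : dyadic -> R) (N : set nat)
    (G : nat -> set dyadic) (I : nat -> dyadic) : 0 < p -> 0 < q ->
  in_f p q u -> f_atomic_decomposition A p q u N G I ->
  exists m : nat -> R, [/\ forall i, 0 <= m i,
    forall i, N i -> dyadic_mass (G i) (fun J => `|u J| `^ q)
                       = (m i * dlen R (I i))%:E &
    (\esum_(i in N) (m i `^ (p / q) * dlen R (I i))%:E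
      <= (A (2%:R * p / q)%R * fine (fnorm p q u) `^ p)%:E)%E].
Proof.
move=> p0 q0 fu [_ _ _ uG _ _ _]; set r := 2%:R * p / q.
set v := fun J => `|u J| `^ (q / 2%:R); set a := fun J => `|u J| `^ q.
have a0 J : 0 <= a J by exact: powR_ge0.
have r0 : 0 < r by rewrite divr_gt0// mulr_gt0.
have fin_u : fnorm p q u \is a fin_num by rewrite ge0_fin_numE// fnorm_ge0.
rewrite poweR_hardy_norm// -(fineK fin_u) poweR_EFin -EFinM fineK//.
set K := A r * _ => leK.
pose e i := Lnorm (mu01 R) +oo (square_fun 2%:R (restr (G i) v)).
have e0 i : (0 <= e i)%E by exact: Lnorm_ge0.
(* A single term of the sum is already bounded by the finite [K], and [|I i| > 0]. *)
have eoo i : N i -> (e i < +oo)%E.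
  move=> Ni; apply: (@lty_poweRy _ _ r); first by rewrite gt_eqF.
  have : ((dlen R (I i))%:E * poweR (e i) r <= K%:E)%E.
    apply: le_trans leK; apply: esum_ge; exists [set i]; last by rewrite fsbig_set1.
    by split=> // j ->.
  case: (poweR (e i) r) (poweR_ge0 (e i) r) => [c||]// _; first by rewrite ltry.
  by rewrite gt0_muley ?lte_fin ?dlen_gt0.
have me i : N i ->
    (dyadic_mass (G i) a <= (dlen R (I i))%:E * poweR (e i) 2%:R)%E.
  move=> Ni; apply: dyadic_mass_le_esssup => //; first exact: uG.
    move=> t; rewrite /square_fun -poweRrM mulVf// poweRe1; last first.
      by apply: dyadic_sum_ge0 => J; exact: powR_ge0.
    rewrite -/(dyadic_sum _ _ _) dyadic_sum_restr//.
    apply: eq_esum => J _.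
    by rewrite /v ger0_norm ?powR_ge0// -powRrM divfK.
  by move=> t; exact: poweR_ge0.
have mfin i : N i -> dyadic_mass (G i) a \is a fin_num.
  move=> Ni; rewrite ge0_fin_numE ?dyadic_mass_ge0//.
  apply: le_lt_trans (me _ Ni) _.
  have : e i \is a fin_num by rewrite ge0_fin_numE// eoo.
  by move=> /fineK <-; rewrite poweR_EFin -EFinM ltry.
pose m i := fine (dyadic_mass (G i) a) / dlen R (I i).
have m0 i : 0 <= m i.
  by rewrite divr_ge0 ?fine_ge0 ?dyadic_mass_ge0// ltW// dlen_gt0.
exists m; split => //.
  by move=> i Ni; rewrite /m divfK ?gt_eqF ?dlen_gt0// fineK// mfin.
apply: le_trans leK; apply: le_esum => i Ni.
have fin_e : e i \is a fin_num by rewrite ge0_fin_numE// eoo.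
rewrite -/(e i) mulrC EFinM lee_pmul2l ?lte_fin ?dlen_gt0//.
have := me _ Ni; rewrite -(fineK fin_e) !poweR_EFin -(fineK (mfin _ Ni)) -EFinM.
rewrite !lee_fin mulrC -ler_pdivrMr ?dlen_gt0// -/(m i) => le_m.
(* Since [r = 2 * (p / q)], the power [r] of [e i] is the power [p / q] of its square. *)
rewrite /r -mulrA [leRHS]powRrM.
apply: ge0_ler_powR => //; rewrite ?nnegrE ?powR_ge0//.
by rewrite divr_ge0// ltW.
Qed.

End atomic_data.

(** * The factorization of [u] and its norm bound *)

Theorem theorem4p1 (R : realType) (A : R -> R) (hA : atomic_constants A)
    (p q : R) (hp : 1 < p) (hpq : p < q) :
  exists C : R,
  forall (u : dyadic -> R) (N : set nat) (G : nat -> set dyadic)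
    (I : nat -> dyadic) (omega : dyadic -> R),
  in_f p q u -> (exists J, u J <> 0) ->
  f_atomic_decomposition A p q u N G I ->
  (forall i J, N i -> G i J -> omega J = weight A p q u (G i) (I i) J) ->
  let y := y_of q omega in
  let x := x_of p q u y in
  [/\ summable [set: dyadic] (fun J => (omega J)%:E),
      in_f q q y,
      in_X0 p q x,
      forall J, `|u J| = `|x J| `^ (1 - theta p q) * `|y J| `^ theta p q &
      (poweR (X0_norm p q x) (1 - theta p q) * poweR (fnorm q q y) (theta p q)
        <= C%:E * fnorm p q u)%E].
Proof.
have p0 : 0 < p by apply: lt_trans hp.
have q0 : 0 < q by apply: lt_trans hpq.
have /andP[th0 th1] := theta_itv hp hpq.
have th1' : 1 - theta p q != 0 by rewrite subr_eq0 gt_eqF.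
set th := theta p q in th0 th1 th1' *; set r := 2%:R * p / q.
set s := p / q.
have s0 : 0 < s by rewrite divr_gt0.
have s1 : s <= 1 by rewrite ler_pdivrMr// mul1r ltW.
exists ((3%:R * A r) `^ p^-1) => u N G I omega fu [J0 uJ0] dec omegaE y x.
have [_ tG cG uG _ _ _ _] := dec.
pose a J := `|u J| `^ q.
have a0 J : 0 <= a J by exact: powR_ge0.
have a_gt0 J : u J != 0 -> 0 < a J by move=> uJ; rewrite powR_gt0// normr_gt0.
have [m [m0 ma mK]] := atomic_mean p0 q0 fu dec.
set U := fine (fnorm p q u) in mK *.
have U0 : 0 <= U by rewrite fine_ge0// fnorm_ge0.
have UE : fnorm p q u = U%:E.
  by rewrite fineK// ge0_fin_numE// fnorm_ge0.
rewrite -/r -/s in mK; set K := A r * U `^ p in mK.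
have inG J : exists2 i, N i & G i J.
  by have : [set: dyadic] J by []; rewrite -cG => -[i Ni GJ]; exists i.
have m_gt0 i J : N i -> G i J -> u J != 0 -> 0 < m i.
  move=> Ni GJ uJ; have := dyadic_mass_ge a GJ; rewrite ma// lee_fin => le_aJ.
  have := lt_le_trans (mulr_gt0 (a_gt0 _ uJ) (dlen_gt0 J)) le_aJ.
  by rewrite pmulr_lgt0// dlen_gt0.
have K0 : 0 < K.
  have [i Ni GJ] := inG J0.
  have mi0 : 0 < m i `^ s * dlen R (I i).
    by rewrite mulr_gt0 ?dlen_gt0 ?powR_gt0// (m_gt0 _ _ Ni GJ)//; exact/eqP.
  rewrite -lte_fin; apply: lt_le_trans mK.
  apply: (@lt_le_trans _ _ (m i `^ s * dlen R (I i))%:E); first by rewrite lte_fin.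
  apply: esum_ge; exists [set i]; last by rewrite fsbig_set1.
  by split=> // j ->.
have Up0 : 0 < U `^ p.
  rewrite lt_def powR_ge0 andbT; apply: contraTneq K0.
  by rewrite /K => ->; rewrite mulr0 ltxx.
have A0 : 0 < A r by rewrite -(pmulr_lgt0 _ Up0).
(* The [q]-th power of the norm of the block part of [u] is [m i * |I i|], so the denominator of the
   weight is [(m i * |I i|)^(1-s)] and the powers of [|I i|] cancel. *)
have omE i J : N i -> G i J ->
    omega J = m i `^ (s - 1) / K * a J * dlen R J.
  move=> Ni GJ; rewrite (omegaE _ _ Ni GJ) /weight -/r -/s -/U.
  have [uJ|uJ] := eqVneq (u J) 0.
    by rewrite /a uJ normr0 powR0 ?gt_eqF// mulr0 mul0r.
  have mi0 := m_gt0 _ _ Ni GJ uJ; have l0 := dlen_gt0 (R:=R) (I i).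
  have nE : fine (fnorm q q (restr (G i) u)) `^ (q - p)
      = (m i * dlen R (I i)) `^ (1 - s).
    have -> : q - p = q * (1 - s) by rewrite /s; field; rewrite gt_eqF.
    by rewrite powRrM -fine_poweR poweR_fnorm_restr// ma.
  have -> : s - 1 = - (1 - s) by rewrite opprB.
  rewrite nE powRM ?ltW// powRN /K -/(a J).
  have := powR_gt0 (1 - s) mi0; have := powR_gt0 (1 - s) l0.
  by move=> ? ?; field; rewrite !gt_eqF.
have ya J i : N i -> G i J -> `|y J| `^ q = m i `^ (s - 1) / K * a J.
  move=> Ni GJ; rewrite /y /y_of (omE _ _ Ni GJ) mulfK ?gt_eqF ?dlen_gt0//.
  have c0 : 0 <= m i `^ (s - 1) / K * a J.
    by rewrite mulr_ge0 ?divr_ge0 ?powR_ge0// ltW.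
  by rewrite ger0_norm ?powR_ge0// -powRrM mulVf ?gt_eqF// powRr1.
have y0 J : 0 <= y J by exact: powR_ge0.
(* Block [i] contributes [m^(s-1) * m * |I| / K], so the total is at most [K / K]. *)
have mass_y : (dyadic_mass [set: dyadic] (fun J => (`|y J| `^ q)%R) <= 1)%E.
  rewrite (dyadic_mass_bigcup tG cG) => [|J]; last exact: powR_ge0.
  have -> : (\esum_(i in N) dyadic_mass (G i) (fun J => (`|y J| `^ q)%R)
      = \esum_(i in N) ((K^-1)%:E * (m i `^ s * dlen R (I i))%:E))%E.
    apply: eq_esum => i Ni.
    transitivity (dyadic_mass (G i) (fun J => m i `^ (s - 1) / K * a J)).
      by apply: eq_esum => J GJ; rewrite (ya _ _ Ni GJ).
    rewrite dyadic_massZl ?divr_ge0 ?powR_ge0 ?ltW// ma// -!EFinM.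
    by congr EFin; rewrite -(mulr_powRB1 (m0 i) s0); ring.
  rewrite esumZl ?invr_ge0 ?(ltW K0)// => [|i]; last first.
    by rewrite lee_fin mulr_ge0 ?powR_ge0// ltW// dlen_gt0.
  by rewrite muleC lee_pdivrMr ?mul1e.
have fy1 : (fnorm q q y <= 1)%E.
  rewrite -(poweR1r q^-1); apply: le_poweRV => //; first exact: fnorm_ge0.
  by rewrite poweR_fnorm_diag.
have fy : in_f q q y by apply: le_lt_trans fy1 _; rewrite ltry.
(* Positivity makes [y^(-theta)] a true inverse of [y^theta] in the factorization. *)
have y_gt0 J : u J != 0 -> 0 < y J.
  move=> uJ; have [i Ni GJ] := inG J; rewrite lt_def y0 andbT.
  apply: contraTneq (a_gt0 _ uJ) => yJ; have := ya _ _ Ni GJ.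
  rewrite yJ normr0 powR0 ?gt_eqF// => /esym/eqP.
  rewrite mulf_eq0 mulf_eq0 invr_eq0 (gt_eqF K0) orbF.
  by rewrite powR_eq0 gt_eqF ?(m_gt0 _ _ Ni GJ)//= => /eqP ->; rewrite ltxx.
have xE J : u J != 0 -> `|x J| `^ (1 - th) = `|u J| * y J `^ (- th).
  move=> uJ; rewrite /x /x_of (negPf uJ) -/th (ger0_norm (powR_ge0 _ _)).
  by rewrite -powRrM mulVf// powRr1 ?mulr_ge0 ?powR_ge0// (ger0_norm (y0 J)).
have x0 J : u J = 0 -> `|x J| `^ (1 - th) = 0.
  by move=> uJ; rewrite /x /x_of uJ eqxx normr0 powR0.
(* The block estimate, with [w] the [q]-th power of the product sequence, handles every test
   sequence of the supremum at once. *)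
have key (z : dyadic -> R) : (fnorm q q z <= 1)%E ->
    (fnorm p q (fun J => (`|x J| `^ (1 - th) * `|z J| `^ th)%R)
      <= ((3%:R * A r) `^ p^-1 * U)%:E)%E.
  move=> fz1.
  have -> : (3%:R * A r) `^ p^-1 * U = (3%:R * K) `^ p^-1.
    rewrite /K mulrA [RHS]powRM ?mulr_ge0 ?ltW// -[in RHS]powRrM.
    by rewrite mulfV ?gt_eqF// powRr1.
  rewrite -poweR_EFin; apply: le_poweRV => //; first exact: fnorm_ge0.
    by rewrite lee_fin mulr_ge0// ltW.
  rewrite poweR_fnorm//.
  apply: (integral_dyadic_sum_le (b := fun J => `|z J| `^ q) tG cG uG)
    ma mK _ _ _ => //.
  - exact: ltW.
  - by rewrite s0.
  - rewrite -poweR_fnorm_diag// -(poweR1r q).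
    by apply: gt0_ler_poweR; rewrite ?in_itv/= ?leey ?andbT ?fnorm_ge0// ltW.
  - move=> i J Ni GJ; have [uJ|uJ] := eqVneq (u J) 0.
      rewrite x0// mul0r normr0 powR0 ?gt_eqF// mulr0.
      by rewrite addr_ge0// mulr_ge0 ?powR_ge0// ltW.
    have mi0 : 0 < m i `^ (s - 1) by rewrite powR_gt0// (m_gt0 _ _ Ni GJ).
    have aJ0 := a_gt0 _ uJ; set b := `|z J| `^ q.
    (* [Y] is [|y J|^q] by [ya], so [w J] takes the form [a J * (b / Y)^theta]. *)
    pose Y := m i `^ (s - 1) / K * a J.
    have Y0 : 0 < Y by rewrite mulr_gt0// divr_gt0.
    have -> : `| `|x J| `^ (1 - th) * `|z J| `^ th| `^ q = a J * (b / Y) `^ th.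
      rewrite ger0_norm ?mulr_ge0 ?powR_ge0// xE// powRM ?mulr_ge0 ?powR_ge0//.
      rewrite (powRM _ (normr_ge0 _) (powR_ge0 _ _)) -/(a J) -mulrA.
      rewrite (powRM _ (powR_ge0 _ _)) ?invr_ge0 ?(ltW Y0)//.
      congr (_ * _); rewrite mulrC /b powRAC; congr (_ * _).
      rewrite powRAC -[y J]ger0_norm// (ya _ _ Ni GJ) -/Y powRN.
      by rewrite -powR_inv1 ?powR_ge0// powRAC powR_inv1// ltW.
    have bY0 : 0 <= b / Y by rewrite divr_ge0 ?powR_ge0// ltW.
    apply: (@le_trans _ _ (m i `^ (s - 1) * (a J * (1 + b / Y)))).
      by rewrite !ler_pM2l// powR_le1D// (ltW th0) ltW.
    (* Equality holds here, because [m^(s-1) * a J / Y = K]: the weight is what turns the second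
       term into [K * b]. *)
    rewrite le_eqVlt; apply/orP; left; apply/eqP.
    by rewrite /Y /a -/b; field; rewrite !gt_eqF.
  - move=> i J Ni GJ mi; have [uJ|uJ] := eqVneq (u J) 0.
      by rewrite x0// mul0r normr0 powR0 ?gt_eqF.
    by have := m_gt0 _ _ Ni GJ uJ; rewrite mi ltxx.
have C0 : 0 <= (3%:R * A r) `^ p^-1 * U by rewrite mulr_ge0// powR_ge0.
have X0le : (X0_norm p q x
    <= poweR ((3%:R * A r) `^ p^-1 * U)%:E (1 - th)^-1)%E.
  apply: ge_ereal_sup => _ [z [_ fz1] <-].
  apply: gt0_ler_poweR; rewrite ?in_itv/= ?leey ?andbT ?fnorm_ge0//.
    by rewrite invr_ge0 subr_ge0 ltW.
  exact: key.
(* The sequence [y] itself is an admissible test, so the supremum is not over the empty set. *)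
have X0ge : (0 <= X0_norm p q x)%E.
  apply: (@le_trans _ _ (poweR (fnorm p q (fun J => (`|x J| `^ (1 - th)
    * `|y J| `^ th)%R)) (1 - th)^-1)); first exact: poweR_ge0.
  by apply: ereal_sup_ubound; exists y.
split => //.
(* The terms of [mass_y] are exactly the values of [omega]. *)
- apply: le_lt_trans (ltry 1); apply: le_trans mass_y.
  apply: le_esum => J _; have [i Ni GJ] := inG J.
  rewrite (ya _ _ Ni GJ) -(omE _ _ Ni GJ) /= lee_fin ger0_norm//.
  rewrite (omE _ _ Ni GJ) mulr_ge0 ?(ltW (dlen_gt0 _))//.
  by rewrite mulr_ge0 ?divr_ge0 ?powR_ge0// ltW.
- by apply: le_lt_trans X0le _; rewrite poweR_EFin ltry.
- move=> J; have [uJ|uJ] := eqVneq (u J) 0.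
    by rewrite x0// uJ normr0 mul0r.
  rewrite xE// (ger0_norm (y0 J)) -mulrA -powRD ?addNr ?eqxx ?gt_eqF ?y_gt0//.
  by rewrite powRr0 mulr1.
(* The factor with [x] carries the whole bound through [X0le]; the factor with [y] is at most 1 by
   [fy1]. *)
- rewrite UE -EFinM -[leRHS]mule1; apply: lee_pmul; rewrite ?poweR_ge0//.
  + have <- : poweR (poweR ((3%:R * A r) `^ p^-1 * U)%:E (1 - th)^-1) (1 - th)
        = ((3%:R * A r) `^ p^-1 * U)%:E.
      by rewrite -poweRrM mulVf// poweRe1 ?lee_fin.
    apply: gt0_ler_poweR; rewrite ?in_itv/= ?leey ?andbT ?lee_fin ?powR_ge0//.
    by rewrite subr_ge0 ltW.
  + rewrite -(poweR1r th); apply: gt0_ler_poweR;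
      rewrite ?in_itv/= ?leey ?andbT ?fnorm_ge0//; exact: ltW.
Qed.
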